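(* Let $m=3$ and $p\in\mathbb{N}^\star$, and consider the equation $x^2\Phi''=(x^3+a_1x^2+a_2x+a_3)\Phi$ with $a_3=\frac{p^2-1}4$. The condition $\lambda(\underline a',p)=0$ on $\underline a'=(a_1,a_2)\in\mathbb{C}^2$ is an isomonodromic deformation condition: on the set $\{\underline a'\in\mathbb{C}^2:\lambda(\underline a',p)=0\}$, both the monodromy matrix $\mathfrak{M}(\underline a',p)$ at the origin and the Stokes structure, i.e. the Stokes-Sibuya connection matrices $\mathfrak{S}_k(a_1,a_2,a_3)$, $k\in\mathbb{Z}$, are fixed (independent of $\underline a'$).
   Context: Write $\underline a=(a_1,a_2,a_3)$; $x$ lies on the universal covering of $\mathbb{C}^\star$; $\omega=e^{2i\pi/3}$ and $\omega^k.\underline a=(\omega^ka_1,\omega^{2k}a_2,\omega^{3k}a_3)$. Solutions at infinity: $\Phi_0(x,\underline a)$ is the unique solution asymptotic at infinity to $x^{-1/4}e^{-\frac23x^{3/2}-a_1x^{1/2}}\phi_0$, $\phi_0$ a formal series in $x^{-1/2}$ with constant term $1$, in every strict sub-sector of $\{|\arg x|<\pi\}$, locally uniformly in $\underline a$; it extends analytically to the universal covering of $\mathbb{C}^\star$ and is entire in $\underline a$. $\Phi_k(x,\underline a)=\Phi_0(\omega^kx,\omega^k.\underline a)$, and the Stokes-Sibuya connection matrix $\mathfrak{S}_k(\underline a)$ is defined by $\begin{pmatrix}\Phi_{k-1}\\ \Phi_k\end{pmatrix}=\mathfrak{S}_k(\underline a)\begin{pmatrix}\Phi_k\\ \Phi_{k+1}\end{pmatrix}$.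 Solutions at the origin, for $p\in\mathbb{N}^\star$: with $s(p)=\frac{1+p}2$, $(f_1,f_2)$ is the fundamental system of solutions uniquely determined by $f_1=x^{s(p)}(1+\sum_{k\ge1}A_kx^k)$ and $f_2=\lambda(\underline a',p)f_1\ln x+x^{s(-p)}(1+\sum_{k\ge1}B_kx^k)$ with $B_p=0$; this defines $\lambda(\underline a',p)\in\mathbb{C}[\underline a']$. The monodromy matrix at the origin $\mathfrak{M}(\underline a',p)$ is defined by $\begin{pmatrix}f_1\\ f_2\end{pmatrix}(e^{2i\pi}x)=\mathfrak{M}(\underline a',p)\begin{pmatrix}f_1\\ f_2\end{pmatrix}(x)$. *)

(* Defs.v *)
From mathcomp Require Import all_boot all_order all_algebra.
From mathcomp Require Import complex.
From mathcomp Require Import all_classical all_reals all_analysis.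

Set Implicit Arguments.
Unset Strict Implicit.
Unset Printing Implicit Defensive.

Import Order.TTheory GRing.Theory Num.Theory.
Import numFieldNormedType.Exports.

Local Open Scope classical_set_scope.
Local Open Scope complex_scope.
Local Open Scope ring_scope.

(* The field of complex numbers, packaged as a numClosedFieldType so that it gets
   the topology and the normed-module structure over itself that every
   numFieldType has; [R[i]] itself comes only with the real scalar action. *)
Definition Cplx (R : realType) : numClosedFieldType := R[i].

Section Equation.
Context {R : realType}.
Local Notation C := (Cplx R).

Definition cexp (z : C) : C :=
  (expR (complex.Re z))%:C *
  (cos (complex.Im z) +i* sin (complex.Im z))%C.

(* The universal covering of the punctured plane is C with covering map
   t |-> exp t. A point x of the covering is represented by its coordinate
   t = ln x, so that arg x = Im t and |x| = exp (Re t). *)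

Definition cpow (t s : C) : C := cexp (s * t).

(* d/dx in the coordinate t: dx = exp t dt. *)
Definition dx (f : C -> C) (t : C) : C := derive1 f t / cexp t.

Definition Ppol (a : C * C * C) (x : C) : C :=
  let: (a1, a2, a3) := a in x ^+ 3 + a1 * x ^+ 2 + a2 * x + a3.

Definition solution (a : C * C * C) (f : C -> C) : Prop :=
  [/\ forall t, derivable f t 1,
      forall t, derivable (dx f) t 1 &
      forall t, cexp t ^+ 2 * dx (dx f) t = Ppol a (cexp t) * f t].

Definition fundamental_system (a : C * C * C) (f g : C -> C) : Prop :=
  [/\ solution a f, solution a g &
      forall c d : C, (forall t, c * f t + d * g t = 0) -> c = 0 /\ d = 0].

(* x^(-1/4) exp (- 2/3 x^(3/2) - a_1 x^(1/2)) *)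
Definition prefactor (a : C * C * C) (t : C) : C :=
  let: (a1, _, _) := a in
  cpow t (- (1 / 4)) *
  cexp (- (2 / 3) * cpow t (3 / 2) - a1 * cpow t (1 / 2)).

(* Poincare asymptotics at infinity of [Phi0 / prefactor] to the formal series
   [\sum_n phi a n * x^(-n/2)], in every sector [|arg x| <= pi - delta], with
   bounds uniform for [a] near any given [a0]. *)
Definition asymptotic_at_infinity (Phi0 : C -> C * C * C -> C)
    (phi : C * C * C -> nat -> C) : Prop :=
  forall (N : nat) (delta : R) (a0 : C * C * C), 0 < delta ->
  exists K rho : R, \forall a \near a0, forall t : C,
    rho <= complex.Re t -> `|complex.Im t| <= pi - delta ->
    `| Phi0 t a / prefactor a t
       - \sum_(0 <= n < N) phi a n * cpow t (- (n%:R / 2)) |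
    <= K%:C * `|cpow t (- (N%:R / 2))|.

Definition is_Phi0 (Phi0 : C -> C * C * C -> C) : Prop :=
  (forall a, solution a (Phi0 ^~ a)) /\
  exists phi : C * C * C -> nat -> C,
    (forall a, phi a 0%N = 1) /\ asymptotic_at_infinity Phi0 phi.

Definition omega : C := cexp (2 * 'i%C * pi%:C / 3).

Definition omega_act (k : int) (a : C * C * C) : C * C * C :=
  let: (a1, a2, a3) := a in
  (omega ^ k * a1, omega ^ (2 * k) * a2, omega ^ (3 * k) * a3).

(* Multiplication by omega^k lifts to the covering as the translation of
   t = ln x by 2 i pi k / 3; in particular Phi_3 and Phi_0 differ. *)
Definition Phi (Phi0 : C -> C * C * C -> C) (k : int) (t : C)
    (a : C * C * C) : C :=
  Phi0 (t + k%:~R * (2 * 'i%C * pi%:C / 3)) (omega_act k a).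

Definition col2 (u v : C) : 'cV[C]_2 := \col_i [:: u; v]`_i.

Definition connection_matrix (Phi0 : C -> C * C * C -> C) (a : C * C * C)
    (k : int) (S : 'M[C]_2) : Prop :=
  forall t, col2 (Phi Phi0 (k - 1) t a) (Phi Phi0 k t a) =
    S *m col2 (Phi Phi0 k t a) (Phi Phi0 (k + 1) t a).

Definition sexp (p : int) : C := (1 + p%:~R) / 2.

(* [f = x^s * \sum_k A_k x^k], the power series converging on the whole plane
   as the equation has no singular point other than 0 and infinity. *)
Definition frobenius (s : C) (A : nat -> C) (f : C -> C) : Prop :=
  forall t, [series A k * cexp t ^+ k]_k @ \oo --> f t / cpow t s.

Definition origin_system (p : nat) (a : C * C * C) (lambda : C)
    (f1 f2 : C -> C) : Prop :=
  fundamental_system a f1 f2 /\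
  exists A B : nat -> C,
    [/\ A 0%N = 1, B 0%N = 1, B p = 0,
        frobenius (sexp p%:Z) A f1 &
        frobenius (sexp (- p%:Z)) B (fun t => f2 t - lambda * f1 t * t)].

(* x |-> exp (2 i pi) x is the translation of t = ln x by 2 i pi. *)
Definition monodromy_matrix (f1 f2 : C -> C) (M : 'M[C]_2) : Prop :=
  forall t, col2 (f1 (t + 2 * 'i%C * pi%:C)) (f2 (t + 2 * 'i * pi%:C)) =
    M *m col2 (f1 t) (f2 t).

Definition coeffs (p : nat) (a' : C * C) : C * C * C :=
  (a'.1, a'.2, (p%:R ^+ 2 - 1) / 4).

End Equation.

(* Main.v *)
Require Import Defs.
From mathcomp Require Import all_boot all_order all_algebra.
From mathcomp Require Import complex ring lra.
From mathcomp Require Import all_classical all_reals all_analysis.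

(** On the set lambda = 0 both matrices can be written down, and their entries
    do not involve the parameters.

    At the origin, lambda = 0 removes the logarithm from f_2, so f_1 and f_2 are
    x^(s(p)) and x^(s(-p)) times entire functions. The exponents
    s(p) = (1+p)/2 and s(-p) = (1-p)/2 differ by an integer, hence a turn around
    0 multiplies both by the same sign eps = (-1)^(p+1)
    ([origin_quasiperiodic]), and the monodromy matrix is eps times the
    identity.

    At infinity, write kappa = e^(i pi/3). On the positive real axis Phi_0 is
    recessive, whereas Phi_{-1} and Phi_1 grow at the same rate with
    Phi_{-1}/Phi_1 tending to kappa ([Phi_positive_ray]). A recessive and a
    dominant solution have nonzero Wronskian ([dominated_wronskian]) and so span
    all the solutions; dividing Phi_{-1} = C Phi_0 + D Phi_1 by Phi_1 and going
    to infinity gives D = kappa. The symmetry x -> omega^k x carries this to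
    Phi_{k-1} = C_k Phi_k + kappa Phi_{k+1} for every k ([Phi_three_term]),
    where C_k may still depend on the parameters.

    The two ends meet through omega^3 = 1: Phi_{k+3} is Phi_k after one turn, so
    Phi_{k+3} = eps Phi_k. Substituting the relation for k into the one for k+1,
    Phi_k = C_{k+1} Phi_{k+1} + kappa eps Phi_{k-1}, and comparing the
    coefficients of Phi_k forces kappa eps C_k = 1 ([Phi_connection]). Thus
    S_k has rows (eps/kappa, kappa) and (1, 0). Both matrices are unique because
    the solutions they act on are linearly independent ([col2_mx_inj]). *)

Set Implicit Arguments.
Unset Strict Implicit.
Unset Printing Implicit Defensive.

Import Order.TTheory GRing.Theory Num.Theory.
Import numFieldNormedType.Exports.

Local Open Scope complex_scope.
Local Open Scope ring_scope.

(** * The exponential of a complex variable *)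

Section ComplexExponential.
Context {R : realType}.
Local Notation C := (Cplx R).
Implicit Types (z w : C) (x : R).

Lemma cexpE x y : cexp (x +i* y : C) = (expR x * cos y +i* (expR x * sin y))%C.
Proof. by rewrite /cexp /=; simpc. Qed.

Lemma cexpD z w : cexp (z + w) = cexp z * cexp w.
Proof.
case: z w => [a b] [c d].
rewrite -[X in cexp X]/((a + c) +i* (b + d))%C !cexpE expRD cosD sinD.
by rewrite [RHS]/GRing.mul /=; congr (_ +i* _)%C; ring.
Qed.

Lemma cexp0 : cexp (0 : C) = 1.
Proof. by rewrite -[0 : C]/(0 +i* 0)%C cexpE expR0 cos0 sin0 mulr1 mulr0. Qed.

Lemma cexp_neq0 z : cexp z != 0.
Proof.
apply/eqP => z0; have /eqP := cexpD z (- z).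
by rewrite subrr cexp0 z0 mul0r oner_eq0.
Qed.

Lemma cexpN z : cexp (- z) = (cexp z)^-1.
Proof.
by apply: (mulfI (cexp_neq0 z)); rewrite -cexpD subrr cexp0 divff// cexp_neq0.
Qed.

Lemma cexpMn z n : cexp (z * n%:R) = cexp z ^+ n.
Proof.
elim: n => [|n IH]; first by rewrite mulr0 cexp0 expr0.
by rewrite exprS -IH -cexpD -natr1 mulrDr mulr1 addrC.
Qed.

Lemma norm_cexp z : `|cexp z| = (expR (complex.Re z))%:C :> C.
Proof.
case: z => a b; rewrite cexpE normc_def /=.
have -> : (expR a * cos b) ^+ 2 + (expR a * sin b) ^+ 2 = expR a ^+ 2.
  by rewrite !exprMn -mulrDr cos2Dsin2 mulr1.
by rewrite sqrtr_sqr ger0_norm// expR_ge0.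
Qed.

Lemma cexp_real x : cexp (x%:C : C) = (expR x)%:C.
Proof. by rewrite cexpE cos0 sin0 mulr1 mulr0. Qed.

Lemma cexp_ipi : cexp ('i%C * pi%:C : C) = -1.
Proof.
have -> : ('i%C * pi%:C : C) = (0 +i* pi)%C by simpc.
rewrite cexpE expR0 cospi sinpi !mul1r.
by apply/eqP; rewrite eq_complex /= oppr0 !eqxx.
Qed.

Lemma cexp_2ipi : cexp (2 * 'i%C * pi%:C : C) = 1.
Proof. by rewrite -mulrA mulrC cexpMn cexp_ipi sqrrN expr1n. Qed.

End ComplexExponential.

(** * Functions with zero complex derivative *)

Section ComplexDerivative.
Context {R : realType}.
Local Open Scope classical_set_scope.
Local Notation C := (Cplx R).
Implicit Types (f : C -> C) (z w v : C).

Lemma norm_ReE z : `|z| = (complex.Re `|z|)%:C :> C.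
Proof. by rewrite RRe_real// normr_real. Qed.

(** A positive element for the order of [R[i]] is real, so the epsilons of the
    topology of [C] can be taken in [R]. *)
Lemma pos_ReE (e : C) : 0 < e -> e = (complex.Re e)%:C /\ 0 < complex.Re e.
Proof.
move=> e0; have ee : (complex.Re e)%:C = e by apply: RRe_real; exact: gtr0_real.
by split=> //; rewrite -ltcR ee.
Qed.

Lemma normc_ge_Im z : `|complex.Im z|%:C <= `|z|.
Proof.
have := @normc_ge_Re R (z * 'i%C); rewrite ReiNIm normrN => /le_trans; apply.
rewrite normrM.
by rewrite [X in _ * X]normc_def /= expr0n expr1n add0r sqrtr1 mulr1.
Qed.

Lemma increment_small f z (e : R) : 0 < e -> derivable f z 1 ->
  derive1 f z = 0 -> \forall k \near (0 : C), `|f (k + z) - f z| <= e%:C * `|k|.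
Proof.
move=> e0 df; rewrite derive1E => f0.
have /eqaddoP /(_ e%:C) := derivable_nbhs df.
rewrite ltcR => /(_ e0).
rewrite f0; apply: filterS => k /=.
rewrite -[X in `|X| <= _]/(f (k *: 1 + z) - (f z + k *: 0)).
by rewrite scaler0 addr0 [k *: _]mulr1.
Qed.

(** Applied to the real and the imaginary part, this reduces vanishing complex
    derivatives to the real mean value theorem. *)
Lemma is_derive_real_line (l : C -> R) f z v (s : R) :
    (forall x y, l (x - y) = l x - l y) -> (forall x, `|l x|%:C <= `|x|) ->
    derivable f (z + s%:C * v) 1 -> derive1 f (z + s%:C * v) = 0 ->
  is_derive s 1 (fun x : R => l (f (z + x%:C * v))) 0.
Proof.
move=> lB lle df f0.
set g := fun x : R => _.
suff H : (fun h => h^-1 *: ((g \o shift s) (h *: (1 : R)) - g s)) @ 0^'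
    --> (0 : R).
  by apply: DeriveDef; [apply/cvg_ex; exists 0 | exact: cvg_lim H].
apply/cvgrPdist_le => e e0.
(* [nv + 1] replaces |v| in the denominators, as v may be 0. *)
pose nv := complex.Re `|v|.
have nv0 : 0 <= nv by rewrite -ler0c -norm_ReE normr_ge0.
have e'0 : 0 < e / (nv + 1) by rewrite divr_gt0// ltr_wpDl.
have /nbhs_ballP[d /= d0 Hd] := increment_small e'0 df f0.
have [dE dd0] := pos_ReE d0.
have D0 : 0 < complex.Re d / (nv + 1) by rewrite divr_gt0// ltr_wpDl.
near=> h.
have h0 : h != 0 by near: h; exact: nbhs_dnbhs_neq.
have hd : `|h| < complex.Re d / (nv + 1).
  by near: h; apply: dnbhs0_lt.
have nhc : `|h%:C : C| = `|h|%:C by rewrite normc_def /= expr0n addr0 sqrtr_sqr.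
have nhv : `|h%:C * v| = (`|h| * nv)%:C.
  by rewrite normrM nhc norm_ReE -rmorphM.
have := Hd (h%:C * v); rewrite /= /ball /= sub0r normrN nhv dE ltcR.
have -> : `|h| * nv < complex.Re d.
  rewrite ltr_pdivlMr ?ltr_wpDl// in hd.
  by apply: le_lt_trans hd; rewrite ler_wpM2l// lerDl.
move=> /(_ isT) H.
rewrite sub0r normrN normrM normfV.
rewrite ler_pdivrMl ?normr_gt0// -lecR.
rewrite /g /= [h *: 1]mulr1 -lB.
apply: (le_trans (lle _)).
have -> : z + (h + s)%:C * v = h%:C * v + (z + s%:C * v).
  by rewrite rmorphD /= mulrDl addrCA addrA.
apply: (le_trans H); rewrite -rmorphM lecR mulrCA ler_wpM2l//.
by rewrite mulrAC ler_pdivrMr ?ltr_wpDl// ler_wpM2l ?lerDl// ltW.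
Unshelve. all: by end_near. Qed.

Lemma derive1_eq0_segment f z w :
    (forall s : R, 0 <= s <= 1 ->
       derivable f (z + s%:C * (w - z)) 1 /\
       derive1 f (z + s%:C * (w - z)) = 0) ->
  f w = f z.
Proof.
move=> H.
have K (l : C -> R) : (forall x y, l (x - y) = l x - l y) ->
    (forall x, `|l x|%:C <= `|x|) -> l (f w) = l (f z).
  move=> lB lle; pose g (x : R) := l (f (z + x%:C * (w - z))).
  have dg (s : R) : 0 <= s <= 1 -> is_derive s 1 g 0.
    by move=> /H[]; exact: is_derive_real_line.
  have [||c _] := @MVT _ g (fun=> 0) 0 1 ltr01.
  - by move=> x; rewrite in_itv /= => /andP[x0 x1]; apply: dg; rewrite !ltW.
  - apply: derivable_within_continuous => x; rewrite in_itv /= => /dg.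
    by case.
  rewrite mul0r => /eqP; rewrite subr_eq0 => /eqP.
  by rewrite /g mul0r addr0 mul1r addrC subrK.
have eRe : complex.Re (f w) = complex.Re (f z).
  apply: (K (@complex.Re R)) => [[a b] [c d]//|x]; exact: normc_ge_Re.
have eIm : complex.Im (f w) = complex.Im (f z).
  apply: (K (@complex.Im R)) => [[a b] [c d]//|x]; exact: normc_ge_Im.
by apply/eqP; rewrite eq_complex eRe eIm !eqxx.
Qed.

End ComplexDerivative.

(** * Wronskians *)

Section Wronskian.
Context {R : realType}.
Local Notation C := (Cplx R).
Implicit Types (a : C * C * C) (f g h : C -> C).

(** The Wronskian for d/dx rather than d/dt: the equation has no first-order
    term in x, which makes this one constant. *)
Definition wronskian f g (t : C) : C := f t * dx g t - g t * dx f t.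

Lemma comp_shift_translate f (c t : C) :
  (fun x => f (x + c)) \o shift t = f \o shift (t + c).
Proof. by apply/funext => x /=; rewrite addrA. Qed.

Lemma derivable_translate f c t :
  derivable f (t + c) 1 -> derivable (fun x => f (x + c)) t 1.
Proof. by rewrite /derivable comp_shift_translate. Qed.

Lemma derive1_translate f c t :
  derive1 (fun x => f (x + c)) t = derive1 f (t + c).
Proof. by rewrite !derive1E /derive comp_shift_translate. Qed.

Lemma derive1_scale f (c t : C) :
  derivable f t 1 -> derive1 (c \*: f) t = c * derive1 f t.
Proof. by move=> df; rewrite !derive1E deriveZ. Qed.

(** The product rule for a 2x2 determinant, with the four derivatives given as
    separate values so that the second derivatives can be supplied by the
    differential equation. *)
Lemma derive1_cross f g F G (t f' g' F' G' : C) :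
    derivable f t 1 -> derivable g t 1 -> derivable F t 1 -> derivable G t 1 ->
    derive1 f t = f' -> derive1 g t = g' ->
    derive1 F t = F' -> derive1 G t = G' ->
  derivable (fun t => f t * G t - g t * F t) t 1 /\
  derive1 (fun t => f t * G t - g t * F t) t =
    (f t * G' + G t * f') - (g t * F' + F t * g').
Proof.
move=> df dg dF dG <- <- <- <-.
have dfG := derivableM df dG; have dgF := derivableM dg dF.
split; first exact: (derivableB dfG dgF).
rewrite !derive1E; apply: etrans (deriveB dfG dgF) _.
exact: (congr2 (fun x y => x - y) (deriveM df dG) (deriveM dg dF)).
Qed.

Lemma solution_derive1 a f t : solution a f ->
  derive1 f t = cexp t * dx f t /\
  derive1 (dx f) t = Ppol a (cexp t) * f t / cexp t.
Proof.
move=> [_ _ /(_ t) <-]; rewrite /dx; have := cexp_neq0 t.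
move: (cexp t) (derive1 f t) (derive1 _ t) => E F' F'' E0.
by split; field.
Qed.

Lemma wronskian_derive a f g t : solution a f -> solution a g ->
  derivable (wronskian f g) t 1 /\ derive1 (wronskian f g) t = 0.
Proof.
move=> sf sg; have [ef eF] := solution_derive1 t sf.
have [eg eG] := solution_derive1 t sg.
case: sf sg => [df ddf _] [dg ddg _].
have [dW W'] := derive1_cross (df t) (dg t) (ddf t) (ddg t) ef eg eF eG.
split=> //; apply: etrans W' _.
have := cexp_neq0 t.
move: (cexp t) (dx f t) (dx g t) (Ppol _ _) => E F G P E0.
by field.
Qed.

Lemma wronskian_cst a f g s t : solution a f -> solution a g ->
  wronskian f g s = wronskian f g t.
Proof.
move=> sf sg; apply: derive1_eq0_segment => x _.
exact: (wronskian_derive _ sf sg).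
Qed.

(** Cramer's rule with Wronskians: h W(f,g) = W(h,g) f + W(f,h) g is an identity
    between functions of t, and the Wronskians are constants. *)
Lemma solution_span a f g h : solution a f -> solution a g -> solution a h ->
  wronskian f g 0 != 0 -> exists c d, forall t, h t = c * f t + d * g t.
Proof.
move=> sf sg sh W0.
exists (wronskian h g 0 / wronskian f g 0), (wronskian f h 0 / wronskian f g 0).
move=> t; have E1 := wronskian_cst 0 t sf sg.
have E2 := wronskian_cst 0 t sh sg; have E3 := wronskian_cst 0 t sf sh.
have key (W A B u v w : C) : W != 0 -> w * W = A * u + B * v ->
    w = A / W * u + B / W * v.
  move=> Wn0 e; apply: (mulIf Wn0); rewrite e.
  by field.
apply: key W0 _; rewrite E1 E2 E3 /wronskian.
move: (f t) (g t) (h t) (dx f t) (dx g t) (dx h t) => F G H F' G' H'.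
by ring.
Qed.

(** A rotation x -> e^c x leaves the operator x^2 d^2/dx^2 invariant, so only
    the potential has to be transformed. *)
Lemma solution_translate a b f c :
  (forall x, Ppol b (cexp c * x) = Ppol a x) ->
  solution b f -> solution a (fun t => f (t + c)).
Proof.
move=> Pab [df ddf ef].
have Edx t : dx (fun t => f (t + c)) t = cexp c * dx f (t + c).
  rewrite /dx derive1_translate cexpD.
  have := cexp_neq0 t; have := cexp_neq0 c.
  move: (cexp t) (cexp c) (derive1 f _) => E F G F0 E0.
  by field; rewrite E0 F0.
have Ef : dx (fun t => f (t + c)) = cexp c \*: (fun t => dx f (t + c)).
  by apply/funext => t; rewrite Edx.
have ddfc t : derivable (fun t => dx f (t + c)) t 1.
  exact: derivable_translate.
split=> t; first exact: derivable_translate.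
  by rewrite Ef; exact: derivableZ.
rewrite Ef {1}/dx derive1_scale// derive1_translate.
have := ef (t + c); rewrite {1}/dx cexpD [_ * cexp c]mulrC Pab => <-.
have := cexp_neq0 t; have := cexp_neq0 c.
move: (cexp t) (cexp c) (derive1 (dx f) _) => E F G F0 E0.
by field; rewrite E0 F0.
Qed.

End Wronskian.

(** * Recessive and dominant solutions on the positive ray *)

Section Limits.
Context {R : realType}.
Local Open Scope classical_set_scope.
Local Notation C := (Cplx R).
Implicit Types (a : C * C * C) (f g h : C -> C).

Lemma cvg_norm_le (f : R -> C) (g : R -> R) (l : C) :
  (\forall s \near +oo, `|f s - l| <= (g s)%:C) ->
  g s @[s --> +oo] --> (0 : R) ->
  f s @[s --> +oo] --> l.
Proof.
move=> fg g0; apply/cvgrPdist_lt => e /pos_ReE[eE e0].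
have {}g0 := (cvgrPdist_lt _ _).1 g0 _ e0.
near=> s; rewrite distrC; apply: (@le_lt_trans _ _ (g s)%:C); first by near: s.
rewrite eE ltcR; apply: (@le_lt_trans _ _ `|0 - g s|); last first.
  by near: s; exact: g0.
by rewrite sub0r normrN ler_norm.
Unshelve. all: by end_near. Qed.

Lemma cvg_mul0 (f g : R -> C) (l : C) : f s @[s --> +oo] --> l ->
  g s @[s --> +oo] --> (0 : C) -> f s * g s @[s --> +oo] --> (0 : C).
Proof.
move=> fl g0; have lim x : x = l * 0 -> f s * g s @[s --> +oo] --> x.
  by move=> ->; exact: (cvgM fl g0).
by apply: lim; rewrite mulr0.
Qed.

Lemma expR_half_cvg0 : expR (- (s / 2)) @[s --> +oo] --> (0 : R).
Proof.
apply: (@cvg_comp _ _ _ (fun s : R => s / 2) (fun y => expR (- y)) _ +oo);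
  last exact: cvgr_expR.
move=> A [M [Mr HM]]; exists (M * 2); split; first exact: num_real.
by move=> s /= Hs; apply: HM; rewrite ltr_pdivlMr.
Qed.

(** The coordinate t = ln x runs through the reals, that is, x tends to infinity
    along the positive real axis. *)
Definition dominated f g :=
  [/\ \forall s \near +oo, f (s : R)%:C != 0,
      \forall s \near +oo, g (s : R)%:C != 0
    & f s%:C / g s%:C @[s --> +oo] --> (0 : C)].

Lemma dominated_independent f g c d : dominated f g ->
  (forall t, c * f t + d * g t = 0) -> c = 0 /\ d = 0.
Proof.
move=> [f0 g0 fg0] e.
have cd : c * (f s%:C / g s%:C) + d @[s --> +oo] --> c * 0 + d.
  exact: (cvgD (cvgM (cvg_cst c) fg0) (cvg_cst d)).
have d0 : d = 0.
  rewrite mulr0 add0r in cd.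
  apply/eqP/negPn/negP => dn0.
  near (pinfty_nbhs R) => s.
  have : c * (f s%:C / g s%:C) + d != 0 by near: s; exact: cvgr_neq0 cd dn0.
  have gs : g s%:C != 0 by near: s.
  apply/negP/negPn; apply/eqP/(mulIf gs).
  by rewrite mul0r mulrDl -mulrA divfK// e.
split=> //; near (pinfty_nbhs R) => s.
have fs : f s%:C != 0 by near: s.
by apply/(mulIf fs); rewrite mul0r -[RHS](e s%:C) d0 mul0r addr0.
Unshelve. all: by end_near. Qed.

(** If the Wronskian vanished, f/g would be constant far out on the ray; that
    constant is the limit 0, against f being nonzero there. *)
Lemma dominated_wronskian a f g : solution a f -> solution a g ->
  dominated f g -> wronskian f g 0 != 0.
Proof.
move=> sf sg [f0 g0 fg0]; apply/eqP => W0.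
have [M [_ HM]] : \forall s \near +oo, f (s : R)%:C != 0 /\ g s%:C != 0.
  by near=> s; split; near: s.
pose s0 := M + 1; pose q t := f t / g t.
have dq (s : R) : s0 <= s -> derivable q s%:C 1 /\ derive1 q s%:C = 0.
  move=> ss; have [_ gs] : f s%:C != 0 /\ g s%:C != 0.
    by apply: HM; rewrite (lt_le_trans _ ss)// ltrDl.
  have [ef _] := solution_derive1 s%:C sf.
  have [eg _] := solution_derive1 s%:C sg.
  case: (sf) (sg) => [df _ _] [dg _ _].
  have dVg := derivableV gs (dg _).
  split; first exact: (derivableM (df _) dVg).
  rewrite derive1E; apply: etrans (deriveM (df _) dVg) _.
  have := deriveV gs (dg _) => ->.
  rewrite -!derive1E ef eg.
  have := wronskian_cst s%:C 0 sf sg; rewrite W0 /wronskian.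
  move: (f _) (g _) (dx f _) (dx g _) (cexp _) gs => F G F' G' E G0 W.
  rewrite -![_ *: _]/(_ * _).
  apply: (mulfI G0); apply: (mulfI G0); rewrite !mulr0.
  (* (f/g)' is -W(f,g)/g^2 up to the factor dx/dt; g^2 has been cleared. *)
  transitivity (- E * (F * G' - G * F')); last by rewrite W mulr0.
  by field.
have qc (s : R) : s0 <= s -> q s%:C = q s0%:C.
  move=> ss; apply: derive1_eq0_segment => x /andP[x0 _].
  have -> : s0%:C + x%:C * (s%:C - s0%:C) = (s0 + x * (s - s0))%:C :> C.
    by rewrite -rmorphB -rmorphM -rmorphD.
  by apply: dq; rewrite lerDl mulr_ge0// subr_ge0.
have q0 : q s0%:C = 0.
  have cq : q s%:C @[s --> +oo] --> q s0%:C.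
    apply: cvg_near_cst; exists s0; split; first exact: num_real.
    by move=> s /ltW /qc.
  exact: (cvg_unique _ cq fg0).
have [fs gs] : f s0%:C != 0 /\ g s0%:C != 0 by apply: HM; rewrite ltrDl.
by move/eqP: q0; rewrite mulf_eq0 invr_eq0 (negPf fs) (negPf gs).
Unshelve. all: by end_near. Qed.

End Limits.

(** * Asymptotics of Phi_{-1}, Phi_0 and Phi_1 on the positive ray *)

Section Asymptotics.
Context {R : realType}.
Local Open Scope classical_set_scope.
Local Notation C := (Cplx R).
Implicit Types (a : C * C * C) (t : C).

Local Notation theta := (2 * 'i%C * pi%:C / 3 : C).

Lemma omega_exp (k : int) : (omega : C) ^ k = cexp (k%:~R * theta).
Proof.
case: k => n.
  by rewrite -exprnP /omega -cexpMn mulrC.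
rewrite NegzE -exprnN /omega -cexpMn -cexpN mulrNz mulNr.
by rewrite [_%:~R * _]mulrC.
Qed.

(** The prefactor with the sign in its exponential reversed, the common growth rate
    of Phi_1 and Phi_{-1} on the positive ray. *)
Definition dominant a t : C :=
  let: (a1, _, _) := a in
  cexp (- (t / 4)) * cexp (2 / 3 * cpow t (3 / 2) + a1 * cpow t (1 / 2)).

Lemma dominant_neq0 a t : dominant a t != 0.
Proof. by case: a => [[a1 a2] a3]; rewrite mulf_neq0// cexp_neq0. Qed.

Lemma prefactor_neq0 a t : prefactor a t != 0.
Proof. by case: a => [[a1 a2] a3]; rewrite mulf_neq0// cexp_neq0. Qed.

(** For e odd, a rotation by e thirds of a turn adds e pi to the argument of
    x^(3/2). It also changes the sign of a_1 x^(1/2): the factor omega^e on a_1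
    contributes 2 e pi/3 and x^(1/2) the remaining e pi/3. Only the power
    x^(-1/4) leaves a constant behind. *)
Lemma prefactor_omega_act (e : int) a t :
    cexp (e%:~R * ('i%C * pi%:C)) = -1 :> C ->
  prefactor (omega_act e a) (t + e%:~R * theta) =
    cexp (- (e%:~R * ('i%C * pi%:C / 6))) * dominant a t.
Proof.
case: a => [[a1 a2] a3] He; rewrite /prefactor /dominant /omega_act /cpow.
rewrite omega_exp.
have -> : 3 / 2 * (t + e%:~R * theta) = 3 / 2 * t + e%:~R * ('i%C * pi%:C).
  by field.
rewrite [cexp (3 / 2 * t + _)]cexpD He [cexp (e%:~R * theta) * _]mulrC.
have -> : a1 * cexp (e%:~R * theta) * cexp (1 / 2 * (t + e%:~R * theta)) =
   - (a1 * cexp (1 / 2 * t)).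
  rewrite -mulrA -cexpD.
  have -> : e%:~R * theta + 1 / 2 * (t + e%:~R * theta) =
    1 / 2 * t + e%:~R * ('i%C * pi%:C).
    by field.
  by rewrite cexpD He mulrN1 mulrN.
have -> : - (1 / 4) * (t + e%:~R * theta) =
   - (e%:~R * ('i%C * pi%:C / 6)) + - (t / 4).
  by field.
by rewrite cexpD -mulrA; congr (_ * (_ * cexp _)); ring.
Qed.

(** With y = |x|^(1/2) the quotient has modulus
    exp(- 4/3 y^3 - 2 Re(a_1) y), which is at most exp(- y) as soon as
    y^2 >= y >= 1 + max(0, - 2 Re(a_1)). *)
Lemma prefactor_recessive a :
  prefactor a s%:C / dominant a s%:C @[s --> +oo] --> (0 : C).
Proof.
case: a => [[a1 a2] a3]; apply: cvg_norm_le expR_half_cvg0.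
pose b := complex.Re a1.
exists (Num.max 0 (- 2 * b) * 2); split; first exact: num_real.
move=> s; rewrite -ltr_pdivlMr// gt_max => /andP[s0 sb].
rewrite subr0 /prefactor /dominant /cpow.
set A := cexp _; set B := cexp _; set D := cexp _; set E := cexp _.
have -> : A * B / (D * E) = B / E.
  have -> : A = D by rewrite /A /D; congr cexp; field.
  by field; rewrite !cexp_neq0.
rewrite /B /E -cexpN -cexpD norm_cexp lecR ler_expR.
set y := expR (s / 2).
have y1 : 1 + s / 2 <= y by exact: expR_ge1Dx.
have -> : 3 / 2 * s%:C = (s / 2 * 3)%:C :> C.
  by rewrite !rmorphM fmorphV !rmorph_nat; field.
have -> : 1 / 2 * s%:C = (s / 2)%:C :> C.
  by rewrite rmorphM fmorphV rmorph_nat; field.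
rewrite !cexp_real expRM_natr -/y.
have -> : - (2 / 3) * (y ^+ 3)%:C - a1 * y%:C - (2 / 3 * (y ^+ 3)%:C + a1 * y%:C)
   = (- (4 / 3) * y ^+ 3)%:C - a1 * (2 * y)%:C :> C.
  by rewrite !rmorphM rmorphN rmorphM fmorphV !rmorph_nat; field.
have -> : complex.Re ((- (4 / 3) * y ^+ 3)%:C - a1 * (2 * y)%:C) =
    - (4 / 3) * y ^+ 3 - b * (2 * y).
  rewrite /b; case: (a1) => u v /=; ring.
have y2 : y <= y ^+ 2 by rewrite ler_eXnr//; lra.
have H : 0 <= y * (4 / 3 * y ^+ 2 + 2 * b - 1) by apply: mulr_ge0; lra.
have {}H : 0 <= 4 / 3 * y ^+ 3 + 2 * b * y - y by apply: le_trans H _; lra.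
lra.
Qed.

(** The first-order case of the asymptotic expansion, on the ray of argument y.
    The sector of half-opening pi - pi/3 just contains the arguments 2 pi/3 and
    - 2 pi/3 at which Phi_1 and Phi_{-1} evaluate Phi_0. *)
Lemma Phi0_equiv_prefactor (Phi0 : C -> C * C * C -> C) a (y : R) :
    is_Phi0 Phi0 -> `|y| <= pi - pi / 3 ->
  Phi0 (s%:C + 'i%C * y%:C) a / prefactor a (s%:C + 'i%C * y%:C)
    @[s --> +oo] --> (1 : C).
Proof.
move=> [_ [phi [phi0 asy]]] hy.
have p3 : 0 < pi / 3 :> R by rewrite divr_gt0// pi_gt0.
have [K [rho /nbhs_singleton H]] := asy 1%N (pi / 3) a p3.
apply: (@cvg_norm_le _ _ (fun s => K * expR (- (s / 2)))); last first.
  rewrite -[X in _ --> X](mulr0 K).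
  exact: (cvgM (cvg_cst K) expR_half_cvg0).
exists rho; split; first exact: num_real.
move=> s rs; have := H (s%:C + 'i%C * y%:C).
have -> : (s%:C + 'i%C * y%:C : C) = (s +i* y)%C by simpc.
move=> /(_ (ltW rs) hy); rewrite big_nat1 phi0 /cpow norm_cexp -rmorphM.
rewrite mul0r oppr0 mul0r cexp0 mulr1; congr (_ <= (_ * expR _)%:C).
have -> : - (1 / 2) = (- (1 / 2))%:C :> C.
  by rewrite rmorphN fmorph_div rmorph1 rmorph_nat.
by rewrite /=; ring.
Qed.

Lemma omega3 : (omega : C) ^+ 3 = 1.
Proof. by rewrite /omega -cexpMn divfK ?pnatr_eq0// cexp_2ipi. Qed.

Lemma omega_neq0 : (omega : C) != 0. Proof. exact: cexp_neq0. Qed.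

Lemma omega_actD j k a : omega_act (k + j) a = omega_act j (omega_act k a).
Proof.
case: a => [[a1 a2] a3]; rewrite /omega_act !mulrDr !expfzDr ?omega_neq0//.
by congr (_, _, _); ring.
Qed.

Lemma omega_act0 a : omega_act 0 a = a.
Proof.
by case: a => [[a1 a2] a3]; rewrite /omega_act !mulr0 !expr0z !mul1r.
Qed.

Lemma omega_act3 a : omega_act 3 a = a.
Proof.
case: a => [[a1 a2] a3]; rewrite /omega_act.
rewrite -[omega ^ 3]/(omega ^+ 3) -[omega ^ (2 * 3)]/(omega ^+ (3 * 2)).
rewrite -[omega ^ (3 * 3)]/(omega ^+ (3 * 3)).
by rewrite !exprM omega3 !expr1n !mul1r.
Qed.

Lemma PhiD Phi0 (k j : int) t a :
  Phi Phi0 (k + j) t a = Phi Phi0 j (t + k%:~R * theta) (omega_act k a).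
Proof. by rewrite /Phi omega_actD rmorphD /= mulrDl addrA. Qed.

Lemma Ppol_omega_act (k : int) a (x : C) :
  Ppol (omega_act k a) (cexp (k%:~R * theta) * x) = Ppol a x.
Proof.
case: a => [[a1 a2] a3]; rewrite /Ppol /omega_act -omega_exp.
rewrite ![_ * k]mulrC -!exprz_exp.
have w3 : (omega ^ k : C) ^+ 3 = 1.
  by rewrite exprnP exprz_exp mulrC -exprz_exp -exprnP omega3 exp1rz.
rewrite -!exprnP w3; move: (omega ^ k) w3 => w w3.
transitivity (w ^+ 3 * (x ^+ 3 + a1 * x ^+ 2 + a2 * x) + a3).
  by ring.
by rewrite w3 mul1r.
Qed.

Lemma Phi_solution Phi0 (k : int) a : is_Phi0 Phi0 ->
  solution a (fun t => Phi Phi0 k t a).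
Proof.
move=> [sol _].
exact: (solution_translate (Ppol_omega_act k a) (sol (omega_act k a))).
Qed.

(** Up to factors tending to 1, Phi_0 is the prefactor and Phi_1, Phi_{-1} are
    the dominant function times h^-1 and h, where h = e^(i pi/6) comes from the
    power x^(-1/4); hence the limit h^2 of their quotient. *)
Lemma Phi_positive_ray Phi0 a : is_Phi0 Phi0 ->
  dominated (fun t => Phi Phi0 0 t a) (fun t => Phi Phi0 1 t a) /\
  Phi Phi0 (-1) s%:C a / Phi Phi0 1 s%:C a @[s --> +oo]
    --> (cexp ('i%C * pi%:C / 3) : C).
Proof.
move=> hPhi0; set kappa : C := cexp _.
pose h : C := cexp ('i%C * pi%:C / 6).
have h0 : h != 0 by exact: cexp_neq0.
have p0 : 0 <= (pi : R) by exact: pi_ge0.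
have b0 : `|0 : R| <= pi - pi / 3 by rewrite normr0; lra.
have b1 : `|2 * pi / 3 : R| <= pi - pi / 3 by rewrite ger0_norm; lra.
have b2 : `|- (2 * pi / 3) : R| <= pi - pi / 3 by rewrite normrN ger0_norm; lra.
pose q b (y : R) (s : R) :=
  Phi0 (s%:C + 'i%C * y%:C) b / prefactor b (s%:C + 'i%C * y%:C).
have u1 : q a 0 s @[s --> +oo] --> (1 : C) := Phi0_equiv_prefactor _ hPhi0 b0.
have v1 : q (omega_act 1 a) (2 * pi / 3) s @[s --> +oo] --> (1 : C)
  := Phi0_equiv_prefactor _ hPhi0 b1.
have w1 : q (omega_act (-1) a) (- (2 * pi / 3)) s @[s --> +oo] --> (1 : C)
  := Phi0_equiv_prefactor _ hPhi0 b2.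
have E0 s : Phi Phi0 0 s%:C a = q a 0 s * prefactor a s%:C.
  by rewrite /Phi /q mul0r addr0 omega_act0 mulr0 addr0 divfK// prefactor_neq0.
have E1 s : Phi Phi0 1 s%:C a =
    q (omega_act 1 a) (2 * pi / 3) s * (h^-1 * dominant a s%:C).
  have -> : h^-1 * dominant a s%:C =
      prefactor (omega_act 1 a) (s%:C + 1%:~R * theta).
    by rewrite prefactor_omega_act ?mul1r ?cexp_ipi// cexpN.
  rewrite /q.
  have -> : s%:C + 'i%C * (2 * pi / 3)%:C = s%:C + 1%:~R * theta :> C.
    by rewrite !rmorphM fmorphV !rmorph_nat; field.
  by rewrite /Phi divfK// prefactor_neq0.
have E2 s : Phi Phi0 (-1) s%:C a =
    q (omega_act (-1) a) (- (2 * pi / 3)) s * (h * dominant a s%:C).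
  have -> : h * dominant a s%:C =
      prefactor (omega_act (-1) a) (s%:C + (-1)%:~R * theta).
    rewrite prefactor_omega_act ?mulN1r ?opprK// cexpN cexp_ipi.
    by rewrite invrN invr1.
  rewrite /q.
  have -> : s%:C + 'i%C * (- (2 * pi / 3))%:C =
      s%:C + (-1)%:~R * theta :> C.
    by rewrite rmorphN !rmorphM fmorphV !rmorph_nat; field.
  by rewrite /Phi divfK// prefactor_neq0.
have u0 : \forall s \near +oo, q a 0 s != 0.
  exact: cvgr_neq0 u1 (oner_neq0 _).
have v0 : \forall s \near +oo, q (omega_act 1 a) (2 * pi / 3) s != 0.
  exact: cvgr_neq0 v1 (oner_neq0 _).
split; first split.
- apply: filterS u0 => s us; rewrite E0.
  exact: (mulf_neq0 us (prefactor_neq0 _ _)).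
- apply: filterS v0 => s vs; rewrite E1.
  by apply: (mulf_neq0 vs (mulf_neq0 _ (dominant_neq0 _ _))); rewrite invr_neq0.
- cbv beta.
  have -> : (fun s : R => Phi Phi0 0 s%:C a / Phi Phi0 1 s%:C a) = (fun s =>
      q a 0 s * (q (omega_act 1 a) (2 * pi / 3) s)^-1 *
      (h * (prefactor a s%:C / dominant a s%:C))).
    have key (u p v d k : C) :
        u * p / (v * (k^-1 * d)) = u * v^-1 * (k * (p / d)).
      by rewrite !invfM invrK; ring.
    by apply/funext => s; rewrite E0 E1 key.
  apply: cvg_mul0 (cvgM u1 (cvgV (oner_neq0 _) v1)) _.
  exact: (cvg_mul0 (cvg_cst h) (prefactor_recessive a)).
- have -> : (fun s : R => Phi Phi0 (-1) s%:C a / Phi Phi0 1 s%:C a) = (fun s =>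
      q (omega_act (-1) a) (- (2 * pi / 3)) s *
      (q (omega_act 1 a) (2 * pi / 3) s)^-1 * (h * h)).
    have key (w v d k : C) : d != 0 ->
        w * (k * d) / (v * (k^-1 * d)) = w * v^-1 * (k * k).
      move=> d0; rewrite !invfM invrK.
      transitivity (w * v^-1 * (k * k) * (d * d^-1)); first by ring.
      by rewrite divff// mulr1.
    by apply/funext => s; rewrite E2 E1 key// dominant_neq0.
  have -> : kappa = 1 * 1^-1 * (h * h).
    by rewrite invr1 !mul1r -cexpD; congr cexp; field.
  exact: (cvgM (cvgM w1 (cvgV (oner_neq0 _) v1)) (cvg_cst (h * h))).
Qed.

End Asymptotics.

(** * Three-term relations and monodromy *)

Section Connection.
Context {R : realType}.
Local Open Scope classical_set_scope.
Local Notation C := (Cplx R).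
Implicit Types (a : C * C * C) (f g : C -> C).

Local Notation theta := (2 * 'i%C * pi%:C / 3 : C).
Local Notation period := (2 * 'i%C * pi%:C : C).
Local Notation kappa := (cexp ('i%C * pi%:C / 3) : C).

Definition independent f g :=
  forall c d : C, (forall t, c * f t + d * g t = 0) -> c = 0 /\ d = 0.

(** Both here and in [Phi_three_term], the case of general k is the case k = 0
    with the rotated parameters omega^k.a, by [PhiD]. *)
Lemma Phi_independent Phi0 (k : int) a : is_Phi0 Phi0 ->
  independent (fun t => Phi Phi0 k t a) (fun t => Phi Phi0 (k + 1) t a).
Proof.
move=> hPhi0 c d e; have [dom _] := Phi_positive_ray (omega_act k a) hPhi0.
apply: (dominated_independent dom) => t.
by have := e (t - k%:~R * theta); rewrite -{1}[k]addr0 !PhiD subrK.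
Qed.

Lemma Phi_wronskian Phi0 a : is_Phi0 Phi0 ->
  wronskian (fun t => Phi Phi0 0 t a) (fun t => Phi Phi0 1 t a) 0 != 0.
Proof.
move=> hPhi0; have [dom _] := Phi_positive_ray a hPhi0.
by apply: dominated_wronskian dom; exact: Phi_solution.
Qed.

(** Since Phi_0 and Phi_1 span the solutions, Phi_{-1} = C Phi_0 + D Phi_1.
    Dividing by Phi_1 and going to infinity along the positive ray gives
    D = kappa, as Phi_0/Phi_1 tends to 0. *)
Lemma Phi_three_term_at0 Phi0 a : is_Phi0 Phi0 ->
  exists c, forall t,
    Phi Phi0 (-1) t a = c * Phi Phi0 0 t a + kappa * Phi Phi0 1 t a.
Proof.
move=> hPhi0; have [[f0 g0 fg0] lim] := Phi_positive_ray a hPhi0.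
have [c [d e]] := solution_span (Phi_solution 0 a hPhi0) (Phi_solution 1 a hPhi0)
  (Phi_solution (-1) a hPhi0) (Phi_wronskian a hPhi0).
exists c => t; rewrite e; congr (_ + _ * _).
have lim2 : Phi Phi0 (-1) s%:C a / Phi Phi0 1 s%:C a
    @[s --> +oo] --> (0 + d : C).
  apply: cvg_trans (cvgD (cvg_mul0 (cvg_cst c) fg0) (cvg_cst d)).
  apply: near_eq_cvg; near=> s.
  have gs : Phi Phi0 1 s%:C a != 0 by near: s; exact: g0.
  have key (x y z : C) : z != 0 -> c * (x / z) + d = (c * x + d * z) / z.
    by move=> z0; field.
  by rewrite e; exact: key.
have := cvg_unique _ lim2 lim; rewrite add0r; apply.
exact: norm_hausdorff.
Unshelve. all: by end_near. Qed.

Lemma Phi_three_term Phi0 (k : int) a : is_Phi0 Phi0 ->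
  exists c, forall t,
    Phi Phi0 (k - 1) t a = c * Phi Phi0 k t a + kappa * Phi Phi0 (k + 1) t a.
Proof.
move=> hPhi0; have [c e] := Phi_three_term_at0 (omega_act k a) hPhi0.
by exists c => t; rewrite -{2}[k]addr0 !PhiD.
Qed.

(** In the coordinate t = ln x, a turn around the origin is the translation by
    2 i pi. *)
Definition quasiperiodic (eps : C) f := forall t, f (t + period) = eps * f t.

Lemma frobenius_quasiperiodic s A f :
  frobenius s A f -> quasiperiodic (cexp (s * period)) f.
Proof.
move=> fA t; have := fA (t + period).
rewrite cexpD cexp_2ipi mulr1 => /(cvg_unique (@norm_hausdorff _ _)) /(_ (fA t)).
have key (u v x y : C) : x != 0 -> y != 0 -> u / (x * y) = v / x -> u = y * v.
  by move=> x0 y0 e; rewrite -[u](divfK (mulf_neq0 x0 y0)) e; field.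
by rewrite /cpow mulrDr cexpD; apply: key; exact: cexp_neq0.
Qed.

Lemma quasiperiodic_lin eps f g (c d : C) :
  quasiperiodic eps f -> quasiperiodic eps g ->
  quasiperiodic eps (fun t => c * f t + d * g t).
Proof. by move=> pf pg t; rewrite pf pg; ring. Qed.

(** The equations expressing f1 and f2 in the basis (u, v) can be inverted: D is
    their determinant, and if D = 0 the independence of f1 and f2 makes all the
    coefficients vanish. *)
Lemma quasiperiodic_solution a eps f1 f2 u v g :
    fundamental_system a f1 f2 ->
    quasiperiodic eps f1 -> quasiperiodic eps f2 ->
    solution a u -> solution a v -> wronskian u v 0 != 0 ->
  solution a g -> quasiperiodic eps g.
Proof.
move=> [sf1 sf2 ind] p1 p2 su sv W0 sg.
have [c1 [d1 e1]] := solution_span su sv sf1 W0.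
have [c2 [d2 e2]] := solution_span su sv sf2 W0.
have [c [d e]] := solution_span su sv sg W0.
pose D := c1 * d2 - d1 * c2.
have Du t : D * u t = d2 * f1 t + - d1 * f2 t by rewrite e1 e2 /D; ring.
have Dv t : D * v t = - c2 * f1 t + c1 * f2 t by rewrite e1 e2 /D; ring.
have D0 : D != 0.
  apply/eqP => D0.
  have [d20 /eqP] : d2 = 0 /\ - d1 = 0 by apply: ind => t; rewrite -Du D0 mul0r.
  rewrite oppr_eq0 => /eqP d10.
  have [_ c10] : - c2 = 0 /\ c1 = 0 by apply: ind => t; rewrite -Dv D0 mul0r.
  have [/eqP] : (1 : C) = 0 /\ (0 : C) = 0.
    by apply: ind => t; rewrite e1 c10 d10 !mul0r !addr0 mulr0.
  by rewrite oner_eq0.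
have pu : quasiperiodic eps u.
  move=> t; apply: (mulfI D0); rewrite mulrCA !Du.
  exact: (quasiperiodic_lin d2 (- d1) p1 p2 t).
have pv : quasiperiodic eps v.
  move=> t; apply: (mulfI D0); rewrite mulrCA !Dv.
  exact: (quasiperiodic_lin (- c2) c1 p1 p2 t).
by move=> t; rewrite !e; exact: (quasiperiodic_lin c d pu pv t).
Qed.

(** The two exponents differ by the integer p, and
    e^(2 i pi (1+p)/2) = e^(2 i pi (1-p)/2) = (-1)^(p+1). *)
Lemma origin_quasiperiodic (p : nat) a f1 f2 : origin_system p a 0 f1 f2 ->
  quasiperiodic ((-1) ^+ p.+1) f1 /\ quasiperiodic ((-1) ^+ p.+1) f2.
Proof.
move=> [_ [A [B [_ _ _ fr1 fr2]]]].
have -> : f2 = fun t => f2 t - 0 * f1 t * t.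
  by apply/funext => t; rewrite !mul0r subr0.
have E n : cexp ('i%C * pi%:C * n%:R : C) = (-1) ^+ n by rewrite cexpMn cexp_ipi.
split.
  suff -> : (-1) ^+ p.+1 = cexp (sexp p%:Z * period).
    exact: frobenius_quasiperiodic fr1.
  by rewrite -E; congr cexp; rewrite /sexp -natr1; field.
suff -> : (-1) ^+ p.+1 = cexp (sexp (- p%:Z) * period).
  exact: frobenius_quasiperiodic fr2.
have -> : sexp (- p%:Z) * period =
    'i%C * pi%:C * 1%:R + - ('i%C * pi%:C * p%:R) :> C.
  by rewrite /sexp mulrNz; field.
by rewrite cexpD cexpN !E -exprVn invrN invr1 exprS.
Qed.

Lemma Phi_shift3 Phi0 a (k : int) eps : is_Phi0 Phi0 ->
  (forall g, solution a g -> quasiperiodic eps g) ->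
  forall t, Phi Phi0 (k + 3) t a = eps * Phi Phi0 k t a.
Proof.
move=> hPhi0 per t; rewrite -(per _ (Phi_solution k a hPhi0)).
rewrite addrC PhiD omega_act3.
by congr (Phi _ _ (_ + _) _); field.
Qed.

(** In the three-term relation for k+1, Phi_{k+2} is eps Phi_{k-1}, which the
    relation for k expands again. The result is a linear relation between Phi_k
    and Phi_{k+1}, and the coefficient of Phi_k determines C_k. *)
Lemma Phi_connection Phi0 a eps : is_Phi0 Phi0 -> eps ^+ 2 = 1 ->
    (forall g, solution a g -> quasiperiodic eps g) ->
  forall (k : int) t,
    Phi Phi0 (k - 1) t a =
      eps / kappa * Phi Phi0 k t a + kappa * Phi Phi0 (k + 1) t a.
Proof.
move=> hPhi0 eps2 per k t.
have [c ec] := Phi_three_term k a hPhi0; rewrite ec; congr (_ * _ + _).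
have [c' ec'] := Phi_three_term (k + 1) a hPhi0.
have e3 x : Phi Phi0 (k + 1 + 1) x a = eps * Phi Phi0 (k - 1) x a.
  by rewrite -Phi_shift3//; congr Phi; ring.
have k0 : kappa != 0 by exact: cexp_neq0.
have [] := @Phi_independent Phi0 k a hPhi0
  (1 - kappa * eps * c) (- c' - kappa * eps * kappa).
  move=> x; have := ec' x; rewrite e3 ec addrK.
  move: (Phi _ _ _ _) (Phi _ _ _ _) (kappa) => v u kap e.
  transitivity (u - (c' * v + kap * (eps * (c * u + kap * v)))); first by ring.
  by rewrite -e subrr.
move=> /eqP; rewrite subr_eq0 => /eqP e _.
move: (kappa) k0 e => kap k0 e.
by rewrite -[c]mul1r -eps2; apply: (mulIf k0); rewrite divfK// -[RHS]mulr1 e; ring.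
Qed.

Lemma col2_mx_inj f g (M N : 'M[C]_2) : independent f g ->
  (forall t, M *m col2 (f t) (g t) = N *m col2 (f t) (g t)) -> M = N.
Proof.
move=> ind e; apply/matrixP => i j.
have [H0 H1] : M i 0 - N i 0 = 0 /\ M i 1 - N i 1 = 0.
  apply: ind => t; have /matrixP /(_ i 0) := e t.
  rewrite !mxE !big_ord_recl !big_ord0 !mxE /= !addr0 => /eqP.
  have -> : lift ord0 ord0 = 1 :> 'I_2 by apply/val_inj.
  rewrite -subr_eq0 => /eqP <-.
  by ring.
have [->|->] : j = 0 \/ j = 1.
- by case: j => [[|[|//]]] Hj; [left|right]; apply/val_inj.
- by apply/eqP; rewrite -subr_eq0 H0.
- by apply/eqP; rewrite -subr_eq0 H1.
Qed.

End Connection.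

(** * Constancy of the monodromy and connection matrices *)

Theorem corollary7p8 (R : realType) (p : nat) (hp : (0 < p)%N)
    (Phi0 : Cplx R -> Cplx R * Cplx R * Cplx R -> Cplx R) (hPhi0 : is_Phi0 Phi0)
    (lambda : Cplx R * Cplx R -> Cplx R)
    (f1 f2 : Cplx R * Cplx R -> Cplx R -> Cplx R)
    (hf : forall a' : Cplx R * Cplx R,
       origin_system p (coeffs p a') (lambda a') (f1 a') (f2 a')) :
  exists (M : 'M[Cplx R]_2) (S : int -> 'M[Cplx R]_2),
    forall a' : Cplx R * Cplx R, lambda a' = 0 ->
      unique (monodromy_matrix (f1 a') (f2 a')) M /\
      forall k : int, unique (connection_matrix Phi0 (coeffs p a') k) (S k).
Proof.
pose eps : Cplx R := (-1) ^+ p.+1.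
pose kappa : Cplx R := cexp ('i%C * pi%:C / 3).
exists eps%:M.
exists (fun _ => \matrix_(i, j)
  (if i == 0 then [:: eps / kappa; kappa] else [:: 1; 0])`_j).
move=> a' la'; have := hf a'; rewrite la' => of12.
have [fs _] := of12; have [_ _ ind] := fs.
have [p1 p2] := origin_quasiperiodic of12.
have per g : solution (coeffs p a') g -> quasiperiodic eps g.
  have W0 := Phi_wronskian (coeffs p a') hPhi0.
  apply: (quasiperiodic_solution fs p1 p2 _ _ W0);
  exact: Phi_solution.
have eps2 : eps ^+ 2 = 1 by rewrite -exprM mulnC exprM sqrrN expr1n expr1n.
split=> [|k].
  have HM : monodromy_matrix (f1 a') (f2 a') eps%:M.
    move=> t; rewrite mul_scalar_mx; apply/colP => i; rewrite !mxE.
    by case: i => [[|[|//]]] /= _; [exact: p1 | exact: p2].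
  by split=> // N HN; apply: (col2_mx_inj ind) => t; rewrite -HM HN.
set S := (S in unique _ S).
have HS : connection_matrix Phi0 (coeffs p a') k S.
  move=> t; apply/colP => i; rewrite !mxE !big_ord_recl big_ord0 !mxE /= addr0.
  case: i => [[|[|//]]] /= _; first exact: (Phi_connection hPhi0 eps2 per).
  by rewrite mul1r mul0r addr0.
split=> // N HN.
have key :=
  @col2_mx_inj R _ _ S N (@Phi_independent R Phi0 k (coeffs p a') hPhi0).
apply: key => t.
by rewrite -HS HN.
Qed.
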